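(* Let $X=\{X_0,X_1,\ldots\}$ be a stationary ($X_0\sim\pi$) Harris ergodic Markov chain on $\mathsf{X}$ with invariant distribution $\pi$ and $n$-step kernels $P^n$. Suppose there exist $M:\mathsf{X}\to\mathbb{R}^+$ with $E_\pi M<\infty$ and a decreasing $\psi:\mathbb{N}\to\mathbb{R}^+$ such that $\|P^n(x,\cdot)-\pi(\cdot)\|\le M(x)\psi(n)$ for all $x\in\mathsf{X}$ and $n\in\mathbb{N}$. Then for any integer $a\in[1,n/2]$, any $\epsilon>0$ and any $0<\delta<1$, \[ \Pr\left(|\hat{\xi}_{n,q}-\xi_q|>\epsilon\right)\le 8\exp\left\{-\frac{a\gamma^2}{8}\right\}+22a\left(1+\frac{4}{\gamma}\right)^{1/2}\psi\left(\left\lfloor\frac{n}{2a}\right\rfloor\right)E_\pi M, \] where $\gamma=\gamma(\delta,\epsilon)=\min\{F_V(\xi_q+\epsilon)-q,\ \delta(q-F_V(\xi_q-\epsilon))\}$.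
   Context: $\pi$ is a probability distribution with support $\mathsf{X}\subseteq\mathbb{R}^d$, $d\ge1$; $\mathcal{B}(\mathsf{X})$ is the Borel $\sigma$-algebra; $P^n(x,A)=\Pr(X_{k+n}\in A\mid X_k=x)$. Harris ergodic means $\pi$-irreducible, aperiodic and positive Harris recurrent. $\|\cdot\|$ is the total variation norm, $\|\mu-\nu\|=\sup_A|\mu(A)-\nu(A)|$. $\mathbb{N}=\{1,2,\ldots\}$. The function $g:\mathsf{X}\to\mathbb{R}$ is measurable, $V=g(W)$ with $W\sim\pi$, $F_V$ is the distribution function of $V$, $0<q<1$, and $\xi_q=\inf\{v:F_V(v)\ge q\}$. It is assumed that $F_V$ is absolutely continuous with continuous density $f_V$ satisfying $0<f_V(\xi_q)<\infty$. Set $Y_i=g(X_i)$, let $Y_{n(j)}$ be the $j$th order statistic of $Y_0,\ldots,Y_{n-1}$, and $\hat{\xi}_{n,q}=Y_{n(j)}$ where $j$ is the integer with $j-1<nq\le j$. *)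

(* Defs.v *)
From HB Require Import structures.
From mathcomp Require Export all_boot all_order all_algebra.
From mathcomp Require Export all_classical all_reals all_analysis.

Set Implicit Arguments.
Unset Strict Implicit.
Unset Printing Implicit Defensive.

Export Order.TTheory GRing.Theory Num.Theory.
Export numFieldNormedType.Exports.

Local Open Scope classical_set_scope.
Local Open Scope ring_scope.

(* [state_space X0] is the subset X of R^d as a type, with the topology induced
   by R^d and the corresponding Borel sigma-algebra.  Measurable types are
   pointed in the library, hence the proof that X is nonempty. *)
Definition state_space (R : realType) (d : nat) (X : set 'rV[R]_d)
  (X0 : X !=set0) : Type := set_type X.

Section state_space_instances.
Variables (R : realType) (d : nat) (X : set 'rV[R]_d) (X0 : X !=set0).

HB.instance Definition _ :=
  Topological.copy (state_space X0) (set_type X).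
HB.instance Definition _ :=
  isPointed.Build (state_space X0) (SigSub (mem_set (svalP (cid X0)))).
HB.instance Definition _ :=
  @isMeasurable.Build (sigma_display (@open (state_space X0)))
    (state_space X0) <<s @open (state_space X0) >>
    (@sigma_algebra0 _ setT _) (@sigma_algebraC _ _)
    (@sigma_algebra_bigcup _ setT _).

End state_space_instances.

Definition support (R : realType) (T : topologicalType)
    (mu : set T -> \bar R) : set T :=
  [set x | forall U : set T, open U -> U x -> (0 < mu U)%E].

Definition tv_dist (d : measure_display) (T : measurableType d) (R : realType)
    (mu nu : set T -> \bar R) : \bar R :=
  ereal_sup [set `|mu A - nu A|%E | A in measurable].

Section markov.
Context (d : measure_display) (T : measurableType d) (R : realType).
Implicit Types (P : R.-pker T ~> T) (pi : probability T R).

Fixpoint nstep P (n : nat) : R.-spker T ~> T :=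
  if n is k.+1 then mkcomp_noparam P (nstep P k)
  else kdirac (@measurable_id _ T setT).

(* The Markov property, with the conditional probability
   Pr(X_{n+1} in A | X_0, ..., X_n) = P(X_n, A) written out through its
   defining integrals over the events of sigma(X_0, ..., X_n). *)
Definition markov_chain P (dO : measure_display) (Omega : measurableType dO)
    (Pr : probability Omega R) (X : nat -> {RV Pr >-> T}) : Prop :=
  forall (n : nat) (B : set Omega) (A : set T),
    g_sigma_preimage (fun i : 'I_n.+1 => X i : Omega -> T) B ->
    measurable A ->
    Pr (B `&` X n.+1 @^-1` A) = (\int[Pr]_(w in B) P (X n w) A)%E.

Definition invariant P pi : Prop :=
  forall A : set T, measurable A -> pi A = (\int[pi]_x P x A)%E.

Definition irreducible P pi : Prop :=
  forall A : set T, measurable A -> (0 < pi A)%E ->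
  forall x : T, exists2 n : nat, (0 < n)%N & (0 < nstep P n x A)%E.

Definition aperiodic P : Prop :=
  ~ exists (m : nat) (E : nat -> set T),
      [/\ (2 <= m)%N,
          forall i, (i < m)%N -> measurable (E i) /\ E i !=set0,
          trivIset `I_m E &
          forall i x, (i < m)%N -> E i x -> P x (E (i.+1 %% m)%N) = 1%E].

(* P_x(X_n in A infinitely often) = 1, for every realization of the chain
   started at x. *)
Definition harris_recurrent P pi : Prop :=
  forall A : set T, measurable A -> (0 < pi A)%E ->
  forall (x : T) (dO : measure_display) (Omega : measurableType dO)
         (Pr : probability Omega R) (X : nat -> {RV Pr >-> T}),
    markov_chain P X ->
    (forall B, measurable B -> distribution Pr (X 0%N) B = \d_x B) ->
    Pr (lim_sup_set (fun n => X n @^-1` A)) = 1%E.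

(* Positivity of the recurrent chain is the existence of an invariant
   probability measure, here the given pi. *)
Definition harris_ergodic P pi : Prop :=
  [/\ invariant P pi, irreducible P pi, aperiodic P & harris_recurrent P pi].

End markov.

Section quantile.
Context (R : realType).

(* [f] may take the value +oo: only its value at the quantile is required to
   be finite. *)
Definition continuous_density (F : R -> R) (f : R -> \bar R) : Prop :=
  [/\ continuous f, forall v, (0 <= f v)%E &
      forall v, (F v)%:E = (\int[lebesgue_measure]_(u in `]-oo, v]) f u)%E].

Definition quantile (F : R -> R) (q : R) : R := inf [set v | q <= F v].

(* [j] counts from 1. *)
Definition order_stat (s : seq R) (j : nat) : R := nth 0 (sort <=%R s) j.-1.

End quantile.

(* Main.v *)
Require Import Defs.
From mathcomp Require Import measurable_realfun zify ring lra.

(** The sample quantile exceeds xi + eps exactly when more than n - j of the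
    values g (X_i) do, and lies below xi - eps exactly when at least j of them
    do.  By the choice of j, and because F (xi + eps) - q and q - F (xi - eps)
    are at least gamma, either event makes the number of visits of the chain to
    a fixed set A before time n at least n * (pi A + gamma).  So it is enough to
    bound the upper tail of such a count, for an arbitrary measurable A
    ([hits_tail]).

    Time is cut into 2 * a blocks of length L = p + 1, where p is the integer
    part of n / (2 * a); they cover the times before n.  The even blocks and the
    odd blocks are treated separately: if the whole count exceeds its mean by
    n * gamma, then one of the two partial counts exceeds its own mean by
    n * gamma / 2.  Within a parity class, a block starts L steps after the
    preceding one has ended.  By the Markov property and the total variation
    bound, replacing the count over one block by an independent copy changes the
    expectation of a function with values in [0, 1] by at most psi L * E_pi M
    ([block_mixing]).  This is applied once per block, starting from the
    indicator of the deviation event.  In the independent picture the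
    exponential moments of the blocks multiply, each block having
    sub-Gaussian moments by Hoeffding's argument ([hoeffding_mgf]), and
    Chernoff's method gives exp (- a * gamma^2 / 8) since a * L <= n.

    The error of decoupling is multiplied by a bound on the function that is
    integrated, so it must be paid on indicators and never on exponentials.  This
    is why the induction over the blocks ([spaced_hits_exp]) carries a function
    bounded by 1 together with an exponential that dominates it: the former meets
    the dependence, and only independent blocks are integrated against the
    latter.

    With two parities and two tails this gives 4 * exp (- a * gamma^2 / 8) +
    4 * a * psi p * E_pi M, which is below the stated bound because the factor
    sqrt (1 + 4 / gamma) is at least 1. *)

Set Implicit Arguments.
Unset Strict Implicit.
Unset Printing Implicit Defensive.

Local Open Scope classical_set_scope.
Local Open Scope ring_scope.

(** * Elementary inequalities *)

Lemma ge0_derive_ge (R : realType) (f f' : R -> R) (x : R) :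
  (forall y, is_derive y (1 : R) f (f' y)) ->
  (forall y, 0 <= y -> 0 <= f' y) -> 0 <= x -> f 0 <= f x.
Proof.
move=> df f'0; rewrite le_eqVlt => /predU1P[<-//|x0].
have cf : {within `[0, x], continuous f}.
  apply: continuous_subspaceT => y.
  by apply: differentiable_continuous; apply/derivable1_diffP; apply: ex_derive.
have [c] := MVT x0 (fun y _ => df y) cf.
rewrite in_itv/= => /andP[c0 _] fE; rewrite -subr_ge0 fE subr0.
by rewrite mulr_ge0 ?f'0 ?ltW.
Qed.

(** The inequality cosh x <= exp (x^2 / 2), with the denominators cleared: the
    function exp (- y^2 / 2) * (exp y + exp (- y)) decreases on [0, +oo[ because
    tanh y <= y there, and that bound on tanh follows by differentiating once
    more. *)
Lemma expR_symm_le (R : realType) (x : R) : 0 <= x ->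
  expR x + expR (- x) <= 2 * expR (x ^+ 2 / 2).
Proof.
have tanh_le (y : R) : 0 <= y -> 0 <= y * expR y + y * expR (- y)
    - (expR y - expR (- y)).
  move=> y0.
  pose m (y : R) := y * expR y + y * expR (- y) - (expR y - expR (- y)).
  suff : m 0 <= m y by rewrite /m !mul0r oppr0 subrr !addr0 subr0.
  apply: (@ge0_derive_ge _ m (fun y => y * (expR y - expR (- y)))) => //.
    by move=> z; apply: is_derive_eq; rewrite /GRing.scale /=; ring.
  move=> z z0; rewrite mulr_ge0// subr_ge0 ler_expR; lra.
move=> x0.
pose k (y : R) := - (expR (- (y ^+ 2 / 2)) * (expR y + expR (- y))).
have : k 0 <= k x.
  apply: (@ge0_derive_ge _ k (fun y => expR (- (y ^+ 2 / 2)) *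
      (y * expR y + y * expR (- y) - (expR y - expR (- y))))) => //.
    by move=> z; rewrite /k; apply: is_derive_eq; rewrite /GRing.scale /=; field.
  by move=> y y0; apply: mulr_ge0; [exact: expR_ge0|exact: tanh_le].
rewrite /k expr0n/= mul0r oppr0 !expR0 mul1r lerN2 => h.
by rewrite -ler_pdivrMr ?expR_gt0// -expRN mulrC.
Qed.

Lemma expR_chord_le (R : realType) (x y : R) : `|y| <= 1 ->
  expR (x * y) <= (1 + y) / 2 * expR x + (1 - y) / 2 * expR (- x).
Proof.
move=> /[!ler_norml] /andP[y1 y2].
have h : 0 <= (1 + y) / 2 <= 1 by apply/andP; split; lra.
have /andP[h0 h1] := h.
pose t := @Itv01 R _ h0 h1.
have := convex_expR t x (- x).
rewrite !convRE /= /unstable.onem.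
by congr (expR _ <= _ + _ * _); field.
Qed.

(** The chord of z |-> exp (lam * z) over [m - L, m + L] lies above the
    exponential on [0, L].  Its coefficients are nonnegative because lam >= 0 and
    m is in [0, L], so it can be integrated within the theory of nonnegative
    functions. *)
Lemma expR_affine_majorant (R : realType) (L m lam : R) :
  0 < L -> 0 <= m -> m <= L -> 0 <= lam ->
  exists a b : R, [/\ 0 <= a, 0 <= b,
    forall z, 0 <= z <= L -> expR (lam * z) <= a + b * z &
    a + b * m <= expR (lam * m + (lam * L) ^+ 2 / 2)].
Proof.
move=> L0 m0 mL lam0; set x := lam * L.
have x0 : 0 <= x by rewrite mulr_ge0// ltW.
have mL1 : m / L <= 1 by rewrite ler_pdivrMr// mul1r.
have mL0 : 0 <= m / L by rewrite divr_ge0// ltW.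
exists (expR (lam * m) *
  ((1 - m / L) / 2 * expR x + (1 + m / L) / 2 * expR (- x))).
exists (expR (lam * m) * (expR x - expR (- x)) / (2 * L)); split.
- rewrite mulr_ge0 ?expR_ge0// addr_ge0// mulr_ge0 ?expR_ge0//; lra.
- rewrite divr_ge0 ?mulr_ge0 ?expR_ge0// ?(ltW L0)//.
  by rewrite subr_ge0 ler_expR; lra.
- move=> z /andP[z0 zL]; set y := (z - m) / L.
  have y1 : `|y| <= 1.
    rewrite ler_norml /y ler_pdivlMr// ler_pdivrMr// mulN1r mul1r; lra.
  have -> : lam * z = lam * m + x * y by rewrite /x /y; field; lra.
  rewrite expRD.
  rewrite (_ : _ + _ * z = expR (lam * m) *
      ((1 + y) / 2 * expR x + (1 - y) / 2 * expR (- x))).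
    by rewrite ler_wpM2l ?expR_ge0// expR_chord_le.
  by rewrite /y; field; lra.
rewrite (_ : _ + _ * m = expR (lam * m) * ((expR x + expR (- x)) / 2)).
  by rewrite expRD ler_wpM2l ?expR_ge0// ler_pdivrMr// mulrC expR_symm_le.
by field; lra.
Qed.

(** The value a * gam / (2 * n) is a choice of the Chernoff parameter that
    does not involve the block length L; with the optimal one the same bound
    would come out when a * L = n. *)
Lemma chernoff_exponent (R : realFieldType) (a n L gam : R)
    (lam := a * gam / (2 * n)) :
  1 <= a -> 0 < n -> 0 <= L -> a * L <= n ->
  - (lam * (n * gam / 2)) + a * ((lam * L) ^+ 2 / 2) <= - (a * gam ^+ 2 / 8).
Proof.
move=> a1 n0 L0 aLn.
have -> : - (lam * (n * gam / 2)) + a * ((lam * L) ^+ 2 / 2) =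
    a * gam ^+ 2 / 8 * (((a * L) / n) ^+ 2 - 2).
  by rewrite /lam; field; lra.
rewrite -[leRHS]mulrN1 ler_wpM2l//.
  by rewrite divr_ge0// mulr_ge0 ?sqr_ge0//; lra.
have h0 : 0 <= a * L / n by rewrite divr_ge0 ?mulr_ge0//; lra.
have h1 : a * L / n <= 1 by rewrite ler_pdivrMr ?mul1r.
nra.
Qed.

Lemma exceed_half (R : realFieldType) (x y g u v : R) :
  x + y + g <= u + v -> u < x + g / 2 -> y + g / 2 <= v.
Proof. lra. Qed.

(** Approximation of v by the multiple of 1 / N just below it, written as a
    sum of indicators so that it turns integrals into sums of measures. *)
Lemma staircase_le (R : realType) (v : R) (N : nat) : (0 < N)%N -> 0 <= v <= 1 ->
  let s := \sum_(i < N) N%:R^-1 * (i.+1%:R <= N%:R * v)%R%:R in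
  s <= v <= s + N%:R^-1.
Proof.
move=> N0 /andP[v0 v1] /=; have NR0 : 0 < N%:R :> R by rewrite ltr0n.
have Nv0 : 0 <= N%:R * v by rewrite mulr_ge0 ?ler0n.
set k := Num.trunc (N%:R * v).
have /andP[k1 k2] : k%:R <= N%:R * v < k.+1%:R by exact: truncn_itv.
have kN : (k <= N)%N.
  by rewrite -(ler_nat R) (le_trans k1)// -[leRHS]mulr1 ler_wpM2l.
rewrite -mulr_sumr (_ : \sum_(i < N) _ = k%:R); last first.
  rewrite -(@big_mkord _ _ _ N predT (fun i => (i.+1%:R <= N%:R * v)%R%:R)).
  rewrite (@big_cat_nat _ _ _ k)//= [X in _ + X]big_nat [X in _ + X]big1 ?addr0.
    rewrite big_nat (eq_bigr (fun=> 1)).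
      by rewrite -big_nat sumr_const_nat subn0.
    by move=> i /andP[_ ik]; rewrite -truncn_ge_nat// -/k ik.
  by move=> i /andP[ki _]; rewrite -truncn_ge_nat// -/k ltnNge ki.
apply/andP; split; first by rewrite ler_pdivrMl.
have -> : N%:R^-1 * k%:R + N%:R^-1 = N%:R^-1 * k.+1%:R :> R by rewrite -natr1; ring.
by rewrite ler_pdivlMl// ltW.
Qed.

(** Stated for an arbitrary commutative monoid because it is used both for the
    integer counts and for their real means. *)
Lemma big_alternate_blocks (V : Type) (idx : V) (op : Monoid.com_law idx)
    (F : nat -> V) (L r : nat) :
  let blocks b := \big[op/idx]_(k < r)
    \big[op/idx]_((k.*2 + b) * L <= i < (k.*2 + b) * L + L) F i in
  \big[op/idx]_(0 <= i < r.*2 * L) F i = op (blocks 0%N) (blocks 1%N).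
Proof.
rewrite /= -big_split/=; elim: r => [|r IH]; first by rewrite big_geq ?big_ord0.
rewrite big_ord_recr/= -IH addn0.
have -> : ((r.*2 + 1) * L = r.*2 * L + L)%N by rewrite addn1 mulSn addnC.
rewrite -big_cat_nat ?leq_addr//= -big_cat_nat ?leq_addr//=; last first.
  by rewrite -addnA leq_addr.
by rewrite (_ : r.+1.*2 * L = r.*2 * L + L + L)%N// doubleS !mulSn; lia.
Qed.

(** * Integrals against mixtures of measures *)

Local Open Scope ereal_scope.

Section mixtures.
Import HBNNSimple.

(** The hypothesis is the conclusion for indicators; it extends to simple
    functions by linearity and to nonnegative functions by monotone
    convergence. *)
Lemma ge0_integral_mixture d1 d2 (S : measurableType d1) (T : measurableType d2)
    (R : realType) (mu : {measure set S -> \bar R}) (B : set S)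
    (k : S -> {measure set T -> \bar R}) (nu : {measure set T -> \bar R})
    (u : T -> \bar R) :
  measurable B ->
  (forall A, measurable A -> measurable_fun setT (fun x => k x A)) ->
  (forall A, measurable A -> nu A = \int[mu]_(x in B) k x A) ->
  (forall y, 0 <= u y) -> measurable_fun setT u ->
  \int[nu]_y u y = \int[mu]_(x in B) \int[k x]_y u y.
Proof.
move=> mB mk nuE u0 mu'.
have mkB A : measurable A -> measurable_fun B (fun x => k x A).
  by move=> mA; apply: measurable_funTS; exact: mk.
have mkint (f : T -> \bar R) : (forall y, 0 <= f y) -> measurable_fun setT f ->
    measurable_fun B (fun x => \int[k x]_y f y).
  by move=> f0 mf; apply: measurable_funTS; exact: measurable_fun_integral_kernel.
have simpleE (h : {nnsfun T >-> R}) :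
    \int[nu]_y (h y)%:E = \int[mu]_(x in B) \int[k x]_y (h y)%:E.
  under [RHS]eq_integral do rewrite integralT_nnsfun sintegralE.
  rewrite integralT_nnsfun sintegralE ge0_integral_fsum//; last 2 first.
  - by move=> r; apply: measurable_funeM; exact: mkB.
  - by move=> r x _; rewrite nnsfun_mulemu_ge0.
  apply: eq_fsbigr => r _.
  have [r0|r0] := leP 0%R r.
    by rewrite ge0_integralZl// -?nuE//; exact: mkB.
  rewrite preimage_nnfun0// measure0 mule0.
  by rewrite integral0_eq// => x _; rewrite measure0 mule0.
pose h_ := nnsfun_approx measurableT mu'.
have hu y : limn (fun n => (h_ n y)%:E) = u y.
  by apply/cvg_lim => //; exact: cvg_nnsfun_approx.
have mc (m : {measure set T -> \bar R}) :
    \int[m]_y u y = limn (fun n => \int[m]_y (h_ n y)%:E).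
  rewrite -monotone_convergence//; first by apply: eq_integral => y _; rewrite hu.
  - by move=> n; exact/measurable_EFinP.
  - by move=> n y _; rewrite lee_fin.
  - by move=> y _ a b ab; rewrite lee_fin; exact/lefP/nd_nnsfun_approx.
rewrite mc; under [RHS]eq_integral do rewrite mc.
rewrite monotone_convergence//.
- by congr (limn _); apply/funext => n; rewrite simpleE.
- move=> n; apply: mkint => //; last exact/measurable_EFinP.
  by move=> y; rewrite lee_fin.
- by move=> n x _; apply: integral_ge0 => y _; rewrite lee_fin.
- move=> x _ a b ab; apply: ge0_le_integral => //.
  + by move=> y _; rewrite lee_fin.
  + exact/measurable_EFinP.
  + exact/measurable_EFinP.
  + by move=> y _; rewrite lee_fin; exact/lefP/nd_nnsfun_approx.
Qed.

(** The same passage from sets to functions when the mixed measure is the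
    image of mu restricted to B under X, which is the form of the Markov
    property.  That image is also the mixture of the Dirac masses at X x, so that
    the previous lemma applies to it twice. *)
Lemma ge0_integral_transport d1 d2 (S : measurableType d1) (T : measurableType d2)
    (R : realType) (mu : {measure set S -> \bar R}) (B : set S) (X : S -> T)
    (k : S -> {measure set T -> \bar R}) (u : T -> \bar R) :
  measurable B -> measurable_fun setT X ->
  (forall A, measurable A -> measurable_fun setT (fun x => k x A)) ->
  (forall A, measurable A -> mu (B `&` X @^-1` A) = \int[mu]_(x in B) k x A) ->
  (forall y, 0 <= u y) -> measurable_fun setT u ->
  \int[mu]_(x in B) u (X x) = \int[mu]_(x in B) \int[k x]_y u y.
Proof.
move=> mB mX mk muE u0 mu'.
have mXA A : measurable A -> measurable (X @^-1` A).
  by move=> mA; rewrite -[_ @^-1` _]setTI; exact: mX.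
pose push : {measure set T -> \bar R} :=
  pushforward (mrestr mu mB) X.
pose nu := push mX.
rewrite -(@ge0_integral_mixture _ _ _ _ _ mu B k nu)//; last first.
  by move=> A mA; rewrite -muE//= /nu/= /pushforward /mrestr setIC.
rewrite (@ge0_integral_mixture _ _ _ _ _ mu B (fun x => dirac (X x)) nu)//.
- by apply: eq_integral => x _; rewrite integral_dirac// diracT mul1e.
- move=> A mA; rewrite (_ : (fun _ => _) = EFin \o \1_(X @^-1` A)).
    by apply/measurable_EFinP/measurable_indic/mXA.
  by apply/funext => x; rewrite /= diracE indicE.
- move=> A mA; rewrite /nu/= /pushforward /mrestr.
  by rewrite -integral_indic//; exact: mXA.
Qed.

End mixtures.

(** A uniform bound D on the excess of mu over nu on sets passes to functions
    with values in [0, 1] without losing a constant: such a function is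
    approximated by an average of N indicators, and each of them contributes
    D / N. *)
Lemma integral_le_of_measure_le d (T : measurableType d) (R : realType)
    (mu nu : {measure set T -> \bar R}) (D : R) (u : T -> R) :
  mu setT <= 1 -> (0 <= D)%R ->
  (forall A, measurable A -> mu A <= nu A + D%:E) ->
  measurable_fun setT u -> (forall y, 0 <= u y <= 1)%R ->
  \int[mu]_y (u y)%:E <= \int[nu]_y (u y)%:E + D%:E.
Proof.
move=> mu1 D0 munu mu_ u01.
have u0 y : (0 <= u y)%R by have /andP[] := u01 y.
apply/lee_addgt0Pr => e e0.
pose N := (Num.trunc e^-1).+1.
have NR0 : (0 < N%:R :> R)%R by rewrite ltr0n.
have Ne : (N%:R^-1 <= e :> R)%R.
  by rewrite -[leRHS]invrK lef_pV2 ?posrE ?invr_gt0// ltW// truncnS_gt.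
pose A (i : 'I_N) := [set y | (i.+1%:R <= N%:R * u y)%R].
have mA i : measurable (A i).
  rewrite /A -[X in measurable X]setTI.
  apply: (@measurable_fun_ler _ _ _ _ (fun=> i.+1%:R)%R) => //.
  exact: measurable_funM.
pose s y : R := (\sum_(i < N) N%:R^-1 * \1_(A i) y)%R.
have s0 y : (0 <= s y)%R.
  by apply: sumr_ge0 => i _; rewrite mulr_ge0// invr_ge0 ltW.
have ms : measurable_fun setT s.
  by apply: measurable_sum => i; exact: measurable_funM.
have us y : (s y <= u y <= s y + N%:R^-1)%R.
  have := @staircase_le R (u y) N isT (u01 y).
  rewrite /= (_ : \sum_(i < N) _ = s y)%R//.
  by apply: eq_bigr => i _; rewrite indicE mem_setE.
have ints (m : {measure set T -> \bar R}) :
    \int[m]_y (s y)%:E = \sum_(i < N) N%:R^-1%:E * m (A i).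
  under eq_integral do rewrite -sumEFin.
  rewrite ge0_integral_sum//; last first.
    by move=> i; apply/measurable_EFinP; exact: measurable_funM.
  apply: eq_bigr => i _; under eq_integral do rewrite EFinM.
  rewrite ge0_integralZl//; last exact/measurable_EFinP.
  by rewrite integral_indic// setIT.
apply: (@le_trans _ _ (\int[mu]_y ((s y)%:E + N%:R^-1%:E))).
  apply: ge0_le_integral => //.
  - by move=> y _; rewrite lee_fin.
  - exact/measurable_EFinP.
  - by apply: emeasurable_funD => //; exact/measurable_EFinP.
  - by move=> y _; rewrite lee_fin; have /andP[] := us y.
rewrite ge0_integralD//; [|by move=> y _; rewrite lee_fin|exact/measurable_EFinP].
rewrite integral_cst// ints.
apply: leeD; last first.
  rewrite -[leRHS]mule1 lee_pmul ?measure_ge0// lee_fin// invr_ge0 ltW//.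
apply: (@le_trans _ _ (\sum_(i < N) (N%:R^-1%:E * nu (A i) + (N%:R^-1 * D)%:E))).
  apply: lee_sum => i _; rewrite EFinM -ge0_muleDr ?lee_fin//.
  by rewrite lee_wpmul2l// ?munu// lee_fin invr_ge0 ltW.
rewrite big_split/= -ints sumEFin sumr_const card_ord -mulrnAl -mulr_natl.
rewrite divff ?gt_eqF// mul1r leeD2r//.
apply: ge0_le_integral => //.
- by move=> y _; rewrite lee_fin.
- exact/measurable_EFinP.
- exact/measurable_EFinP.
- by move=> y _; rewrite lee_fin; have /andP[] := us y.
Qed.

Lemma measure_le_tv d (T : measurableType d) (R : realType)
    (mu : {measure set T -> \bar R}) (nu : probability T R) (D : R) :
  tv_dist mu nu <= D%:E ->
  forall A, measurable A -> mu A <= nu A + D%:E.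
Proof.
move=> h A mA; rewrite -leeBlDl ?fin_num_measure//.
apply: le_trans h; apply: (@le_trans _ _ `|mu A - nu A|); first exact: lee_abs.
by apply: ereal_sup_ubound; exists A.
Qed.

(** The weak form of Hoeffding's lemma: the deviation of Z from its mean is
    only known to be at most L in absolute value, which costs the exponent
    (lam * L)^2 / 2 instead of (lam * L)^2 / 8. *)
Lemma hoeffding_mgf d (T : measurableType d) (R : realType)
    (Pr : probability T R) (Z : T -> nat) (L : nat) (m lam : R) :
  (0 < L)%N -> (forall w, Z w <= L)%N ->
  measurable_fun setT (fun w => (Z w)%:R : R) ->
  \int[Pr]_w (Z w)%:R%:E = m%:E -> (0 <= lam)%R ->
  \int[Pr]_w (expR (lam * (Z w)%:R))%:E <=
    (expR (lam * m + (lam * L%:R) ^+ 2 / 2))%:E.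
Proof.
move=> L0 ZL mZ Zm lam0; have LR0 : (0 < L%:R :> R)%R by rewrite ltr0n.
have ZLR w : ((Z w)%:R <= L%:R :> R)%R by rewrite ler_nat.
have mZE : measurable_fun setT (fun w => (Z w)%:R%:E : \bar R).
  exact/measurable_EFinP.
have m0 : (0 <= m)%R.
  by rewrite -lee_fin -Zm; apply: integral_ge0 => w _; rewrite lee_fin.
have mL : (m <= L%:R)%R.
  rewrite -lee_fin -Zm; apply: (@le_trans _ _ (\int[Pr]_w (cst L%:R%:E w))).
    by apply: ge0_le_integral => // w _; rewrite lee_fin.
  rewrite integral_cst// -[leRHS]mule1 lee_wpmul2l ?lee_fin//.
  exact: probability_le1.
have [a [b [a0 b0 chord abm]]] := expR_affine_majorant LR0 m0 mL lam0.
apply: (@le_trans _ _ (\int[Pr]_w (a%:E + b%:E * (Z w)%:R%:E))).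
  apply: ge0_le_integral => //.
  - apply/measurable_EFinP; apply: measurableT_comp => //.
    exact: measurable_funM.
  - by apply: emeasurable_funD => //; exact: measurable_funeM.
  - by move=> w _; rewrite -EFinM -EFinD lee_fin chord// ZLR ler0n.
rewrite ge0_integralD//; last 2 first.
- by move=> w _; rewrite -EFinM lee_fin mulr_ge0.
- exact: measurable_funeM.
rewrite integral_cst// (_ : a%:E * _ = a%:E); last first.
  by rewrite -[RHS]mule1; congr (_ * _); exact: probability_setT.
rewrite ge0_integralZl//.
by rewrite Zm -EFinM -EFinD lee_fin.
Qed.

(** * Integer-valued variables *)

Section nat_fibers.
Context d (T : measurableType d) (R : realType).
Variables (S : T -> nat).
Hypothesis mS : forall s, measurable [set x | S x = s].

Let fibers_cover : \bigcup_s [set x | S x = s] = setT.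
Proof. by rewrite -subTset => x _; exists (S x). Qed.

Lemma measurable_fun_fibers d' (U : measurableType d') (f : nat -> T -> U) :
  (forall s, measurable_fun setT (f s)) ->
  measurable_fun setT (fun x => f (S x) x).
Proof.
move=> mf; rewrite -fibers_cover; apply/measurable_fun_bigcup => // s.
apply: (eq_measurable_fun (f s)); last exact: measurable_funTS.
by move=> x; rewrite inE/= => ->.
Qed.

Lemma measurable_nat_preimage (Q : set nat) : measurable [set x | Q (S x)].
Proof.
rewrite (_ : [set _ | _] = \bigcup_(s in Q) [set x | S x = s]).
  exact: bigcup_measurable.
by apply/seteqP; split => x /=; [exists (S x)|case=> s Qs ->].
Qed.

Lemma le_integral_fibers (mu : {measure set T -> \bar R}) (f h : T -> \bar R) :
  (forall x, 0 <= f x) -> (forall x, 0 <= h x) ->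
  measurable_fun setT f -> measurable_fun setT h ->
  (forall s, \int[mu]_(x in [set x | S x = s]) f x <=
             \int[mu]_(x in [set x | S x = s]) h x) ->
  \int[mu]_x f x <= \int[mu]_x h x.
Proof.
move=> f0 h0 mf mh fh.
have tS : trivIset setT (fun s => [set x | S x = s]).
  by move=> i j _ _ [x [/= <- <-]].
rewrite -fibers_cover !ge0_integral_bigcup//; last 2 first.
- by rewrite fibers_cover.
- by rewrite fibers_cover.
by apply: lee_nneseries => // s _ _; exact: integral_ge0.
Qed.

End nat_fibers.

(** * The chain and its past *)

Section chain.
Context d (T : measurableType d) (R : realType).
Variables (P : R.-pker T ~> T) (pi : probability T R).
Context dO (Omega : measurableType dO) (Pr : probability Omega R).
Variable X : nat -> {RV Pr >-> T}.
Hypothesis chain : markov_chain P X.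
Hypothesis inv_pi : invariant P pi.
Hypothesis init : forall A, measurable A -> distribution Pr (X 0%N) A = pi A.

Definition past t : set (set Omega) :=
  g_sigma_preimage (fun i : 'I_t.+1 => X i : Omega -> T).

Lemma past_measurable t B : past t B -> measurable B.
Proof.
suff : past t `<=` measurable by exact.
apply: smallest_sub; first exact: sigma_algebra_measurable.
rewrite -bigcup_mkord_ord => A [i _ [C mC <-]].
by apply: measurable_funP.
Qed.

Lemma past_X t i A : (i <= t)%N -> measurable A -> past t (X i @^-1` A).
Proof.
move=> it mA; apply: sub_sigma_algebra; rewrite -bigcup_mkord_ord.
exists i; first by rewrite /= ltnS.
by exists A => //; rewrite setTI inordK// ltnS.
Qed.

Lemma past_le s t B : (s <= t)%N -> past s B -> past t B.
Proof.
move=> st; suff : past s `<=` past t by exact.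
apply: smallest_sub; first exact: smallest_sigma_algebra.
rewrite -bigcup_mkord_ord => A [i /= si [C mC <-]].
by rewrite setTI; apply: past_X => //; rewrite inordK// (leq_trans _ st).
Qed.

Definition adapted t (S : Omega -> nat) := forall s, past t [set w | S w = s].

Lemma adapted_measurable t S : adapted t S -> forall s, measurable [set w | S w = s].
Proof. by move=> aS s; exact: past_measurable (aS s). Qed.

Lemma adapted_cst t s : adapted t (fun=> s).
Proof.
move=> s'; rewrite /past /g_sigma_preimage.
set G := (X in <<s X >>).
have := @measurable_cst _ _ (g_sigma_algebraType G) nat setT s.
by move=> /(_ measurableT [set s'] I); rewrite setTI.
Qed.

Lemma adapted_le s t S : (s <= t)%N -> adapted s S -> adapted t S.
Proof. by move=> st aS k; exact: past_le (aS k). Qed.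

Lemma adaptedD t S1 S2 : adapted t S1 -> adapted t S2 ->
  adapted t (fun w => S1 w + S2 w)%N.
Proof.
move=> aS1 aS2 s.
rewrite (_ : [set _ | _] = \bigcup_(k in `I_s.+1)
    ([set w | S1 w = k] `&` [set w | S2 w = s - k]%N)); last first.
  apply/seteqP; split => [w /= <-|w [k /= ks [-> ->]]]; last by rewrite subnKC.
  by exists (S1 w); rewrite /= ?ltnS ?leq_addr// addKn.
move: aS1 aS2; rewrite /adapted /past /g_sigma_preimage.
set G := (X in <<s X >>) => aS1 aS2.
suff : G.-sigma.-measurable (\bigcup_(k in `I_s.+1)
    ([set w | S1 w = k] `&` [set w | S2 w = s - k]%N)) by [].
apply: bigcup_measurable => k _; apply: measurableI; [exact: aS1|exact: aS2].
Qed.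

Lemma adapted_hit t i A : (i <= t)%N -> measurable A ->
  adapted t (fun w => X i w \in A).
Proof.
move=> it mA s.
rewrite (_ : [set _ | _] = X i @^-1` [set x | nat_of_bool (x \in A) = s])//.
apply: past_X => //.
case: s => [|[|s]].
- rewrite (_ : [set _ | _] = ~` A); first exact: measurableC.
  by apply/seteqP; split => x /=; case: (boolP (x \in A)); rewrite ?inE ?notin_setE.
- rewrite (_ : [set _ | _] = A)//.
  by apply/seteqP; split => x /=; case: (boolP (x \in A)); rewrite ?inE ?notin_setE.
- rewrite (_ : [set _ | _] = set0)//.
  by apply/seteqP; split => x /=; case: (boolP (x \in A)).
Qed.

(** The Markov property is given on events of the past.  The events S = s are
    such events, they partition the space, and on each of them V (S w) is a fixed
    function of the state. *)
Lemma markov_step t S (V : nat -> T -> \bar R) : adapted t S ->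
  (forall s y, 0 <= V s y) -> (forall s, measurable_fun setT (V s)) ->
  \int[Pr]_w V (S w) (X t.+1 w) = \int[Pr]_w \int[P (X t w)]_y V (S w) y.
Proof.
move=> aS V0 mV; have mS := adapted_measurable aS.
have mVX : measurable_fun setT (fun w => V (S w) (X t.+1 w)).
  apply: (measurable_fun_fibers mS (f := fun s w => V s (X t.+1 w))) => s.
  exact: measurableT_comp.
have mPV : measurable_fun setT (fun w => \int[P (X t w)]_y V (S w) y).
  apply: (measurable_fun_fibers mS (f := fun s w => \int[P (X t w)]_y V s y)) => s.
  apply: (@measurableT_comp _ _ _ _ _ _ (fun x => \int[P x]_y V s y)) => //.
  by apply: measurable_fun_integral_kernel => //; exact: measurable_kernel.
have eqS s : \int[Pr]_(w in [set w | S w = s]) V (S w) (X t.+1 w) =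
    \int[Pr]_(w in [set w | S w = s]) \int[P (X t w)]_y V (S w) y.
  transitivity (\int[Pr]_(w in [set w | S w = s]) V s (X t.+1 w)).
    by apply: eq_integral => w; rewrite inE/= => ->.
  transitivity (\int[Pr]_(w in [set w | S w = s]) \int[P (X t w)]_y V s y).
    apply: ge0_integral_transport => //.
    - move=> A mA; apply: (@measurableT_comp _ _ _ _ _ _ (fun x => P x A)) => //.
      exact: measurable_kernel.
    - by move=> A mA; apply: chain => //; exact: aS.
  by apply: eq_integral => w; rewrite inE/= => ->.
have PV0 w : 0 <= \int[P (X t w)]_y V (S w) y by exact: integral_ge0.
by apply/eqP; rewrite eq_le !(le_integral_fibers mS)// => s; rewrite eqS.
Qed.

Lemma integral_nstepS k x (u : T -> \bar R) :
  (forall y, 0 <= u y) -> measurable_fun setT u ->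
  \int[nstep P k.+1 x]_z u z = \int[P x]_y \int[nstep P k y]_z u z.
Proof.
move=> u0 mu; apply: ge0_integral_mixture => //.
by move=> A mA; exact: measurable_kernel.
Qed.

(** The kernel [nstep] peels off its first step, so the induction moves the
    present time t forward and applies [markov_step] at the old one. *)
Lemma markov_nstep m t S (V : nat -> T -> \bar R) : adapted t S ->
  (forall s y, 0 <= V s y) -> (forall s, measurable_fun setT (V s)) ->
  \int[Pr]_w V (S w) (X (t + m)%N w) =
  \int[Pr]_w \int[nstep P m (X t w)]_y V (S w) y.
Proof.
elim: m t S => [|m IH] t S aS V0 mV.
  rewrite addn0; apply: eq_integral => w _.
  by rewrite [RHS]integral_dirac// diracT mul1e.
rewrite addnS -addSn IH//; last exact: adapted_le aS.
rewrite (markov_step (V := fun s y => \int[nstep P m y]_z V s z))//; last 2 first.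
- by move=> s y; exact: integral_ge0.
- move=> s; apply: measurable_fun_integral_kernel => // U mU.
  exact: measurable_kernel.
by apply: eq_integral => w _; rewrite integral_nstepS.
Qed.

Lemma stationary t (u : T -> \bar R) :
  (forall y, 0 <= u y) -> measurable_fun setT u ->
  \int[Pr]_w u (X t w) = \int[pi]_y u y.
Proof.
elim: t u => [|t IH] u u0 mu.
  rewrite -(ge0_integral_distribution (X 0%N) mu u0).
  by apply: eq_measure_integral => A mA _; exact: init.
rewrite (@markov_step t (fun=> 0%N) (fun=> u))//; last exact: adapted_cst.
rewrite (IH (fun x => \int[P x]_y u y)); last 2 first.
- by move=> y; exact: integral_ge0.
- apply: measurable_fun_integral_kernel => // U mU.
  exact: measurable_kernel.
apply/esym/ge0_integral_mixture => //.
by move=> A mA; exact: measurable_kernel.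
Qed.

(** * Decoupling a block from the past *)

Variables (M : T -> R) (psi : nat -> R).
Hypothesis mM : measurable_fun setT M.
Hypothesis M_ge0 : forall x, (0 <= M x)%R.
Hypothesis psi_ge0 : forall n, (1 <= n)%N -> (0 <= psi n)%R.
Hypothesis psi_decr :
  forall m n, (1 <= m)%N -> (m <= n)%N -> (psi n <= psi m)%R.
Hypothesis tv_le : forall x n, (1 <= n)%N ->
  tv_dist (nstep P n x) pi <= (M x * psi n)%:E.

(** Given the past, the law of the state at time t + m is within
    M (X t) * psi m of pi, and M (X t) has mean E_pi M by stationarity. *)
Lemma mixing m t S (V : nat -> T -> \bar R) : (1 <= m)%N -> adapted t S ->
  (forall s y, 0 <= V s y <= 1) -> (forall s, measurable_fun setT (V s)) ->
  \int[Pr]_w V (S w) (X (t + m)%N w) <=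
  \int[Pr]_w (\int[pi]_y V (S w) y) + (psi m)%:E * 'E_pi[M].
Proof.
move=> m1 aS V01 mV; have mS := adapted_measurable aS.
have V0 s y : 0 <= V s y by have /andP[] := V01 s y.
have Vfin s y : (fine (V s y))%:E = V s y.
  have /andP[h0 h1] := V01 s y.
  by rewrite fineK// ge0_fin_numE// (le_lt_trans h1) ?ltry.
rewrite (markov_nstep)//.
have mMX : measurable_fun setT (fun w => (M (X t w))%:E).
  by apply/measurable_EFinP; exact: measurableT_comp.
have mpiV : measurable_fun setT (fun w => \int[pi]_y V (S w) y).
  by apply: (measurable_fun_fibers mS (f := fun s w => \int[pi]_y V s y)) => s.
apply: (@le_trans _ _ (\int[Pr]_w
    (\int[pi]_y V (S w) y + (psi m)%:E * (M (X t w))%:E))).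
  apply: ge0_le_integral => //.
  - by move=> w _; exact: integral_ge0.
  - apply: (measurable_fun_fibers mS (f := fun s w =>
      \int[nstep P m (X t w)]_y V s y)) => s.
    apply: (@measurableT_comp _ _ _ _ _ _
      (fun x => \int[nstep P m x]_y V s y)) => //.
    by apply: measurable_fun_integral_kernel => //; exact: measurable_kernel.
  - by apply: emeasurable_funD => //; exact: measurable_funeM.
  - move=> w _; under eq_integral do rewrite -Vfin.
    under [X in _ <= X + _]eq_integral do rewrite -Vfin.
    rewrite -EFinM mulrC; apply: integral_le_of_measure_le.
    + exact: sprob_kernel_le1.
    + by rewrite mulr_ge0// psi_ge0.
    + by apply: measure_le_tv; exact: tv_le.
    + exact: measurableT_comp.
    + by move=> y; rewrite -!lee_fin Vfin.
rewrite ge0_integralD//; last 3 first.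
- by move=> w _; exact: integral_ge0.
- by move=> w _; rewrite -EFinM lee_fin mulr_ge0// psi_ge0.
- exact: measurable_funeM.
rewrite ge0_integralZl//; last 2 first.
- by move=> w _; rewrite lee_fin.
- by rewrite lee_fin psi_ge0.
rewrite (stationary t (u := fun x => (M x)%:E))//.
- by rewrite unlock.
- exact/measurable_EFinP.
Qed.

Section visits.
Variable D : nat -> set T.
Hypothesis mD : forall i, measurable (D i).

Definition hits m n w : nat := (\sum_(m <= i < n) (X i w \in D i))%N.

Lemma adapted_hits t m n : (n <= t.+1)%N -> adapted t (hits m n).
Proof.
elim: n => [|n IH] nt.
  rewrite (_ : hits m 0 = fun=> 0%N); first exact: adapted_cst.
  by apply/funext => w; rewrite /hits big_geq.
have [mn|nm] := leqP m n; last first.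
  rewrite (_ : hits m n.+1 = fun=> 0%N); first exact: adapted_cst.
  by apply/funext => w; rewrite /hits big_geq.
rewrite (_ : hits m n.+1 = fun w => hits m n w + (X n w \in D n))%N.
  by apply: adaptedD; [exact: (IH (ltnW nt))|exact: adapted_hit].
by apply/funext => w; rewrite /hits big_nat_recr.
Qed.

Lemma measurable_hits_preimage m n (Q : set nat) :
  measurable [set w | Q (hits m n w)].
Proof.
apply: measurable_nat_preimage.
exact: adapted_measurable (adapted_hits m (leqnSn n)).
Qed.

Section one_block.
Variable Phi : nat -> R.
Hypothesis Phi01 : forall s, (0 <= Phi s <= 1)%R.

(** The conditional expectation, given X t = x, of Phi evaluated at s plus the
    number of visits during the l time steps that follow t. *)
Fixpoint block_value l t s x : \bar R :=
  if l is l'.+1 then \int[P x]_y block_value l' t.+1 (s + (y \in D t.+1))%N y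
  else (Phi s)%:E.

Let measurable_hit (f : nat -> T -> \bar R) i s :
  (forall s, measurable_fun setT (f s)) ->
  measurable_fun setT (fun y => f (s + (y \in D i))%N y).
Proof.
move=> mf; rewrite (_ : (fun _ => _) = fun y =>
    if y \in D i then f s.+1 y else f s y); last first.
  by apply/funext => y; case: ifPn => _; rewrite ?addn1 ?addn0.
apply: measurable_fun_ifT => //.
by apply: (measurable_fun_bool true); rewrite setTI preimage_mem_true.
Qed.

Lemma block_value_ge0 l t s x : 0 <= block_value l t s x.
Proof.
elim: l t s x => [|l IH] t s x /=; last exact: integral_ge0.
by rewrite lee_fin; have /andP[] := Phi01 s.
Qed.

Lemma block_value_measurable l t s : measurable_fun setT (block_value l t s).
Proof.
elim: l t s => [|l IH] t s //=.
apply: measurable_fun_integral_kernel.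
- by move=> U mU; exact: measurable_kernel.
- by move=> y; exact: block_value_ge0.
- exact: measurable_hit.
Qed.

Lemma block_value_01 l t s x : 0 <= block_value l t s x <= 1.
Proof.
rewrite block_value_ge0/=; elim: l t s x => [|l IH] t s x /=.
  by rewrite lee_fin; have /andP[] := Phi01 s.
apply: (@le_trans _ _ (\int[P x]_y (cst 1 y))).
  apply: ge0_le_integral => //.
  - by move=> y _; exact: block_value_ge0.
  - by apply: measurable_hit => ?; exact: block_value_measurable.
by rewrite integral_cst// mul1e prob_kernel.
Qed.

Lemma integral_block_value l t S : adapted t S ->
  \int[Pr]_w (Phi (S w + hits t.+1 (t.+1 + l) w)%N)%:E =
  \int[Pr]_w block_value l t (S w) (X t w).
Proof.
elim: l t S => [|l IH] t S aS.
  by apply: eq_integral => w _; rewrite /hits addn0 big_geq// addn0.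
rewrite /= -(markov_step
    (V := fun s y => block_value l t.+1 (s + (y \in D t.+1))%N y))//.
- rewrite -(IH t.+1 (fun w => S w + (X t.+1 w \in D t.+1)))%N.
    apply: eq_integral => w _; rewrite /hits -addnA.
    by rewrite [X in (_ + X)%N]big_ltn ?addnS ?addSn// ltnS leq_addr.
  by apply: adaptedD; [exact: adapted_le aS|exact: adapted_hit].
- by move=> s y; exact: block_value_ge0.
- by move=> s; apply: measurable_hit => ?; exact: block_value_measurable.
Qed.

(** The inner integral on the right is over a second copy of the probability
    space: up to the error term, the block Z behaves as if it were independent of
    the past S.  Conditioning on the state at time t + m turns Z into a function
    of that state alone, to which [mixing] applies; stationarity then turns the
    integral of this function against pi back into an expectation over Z. *)
Lemma block_mixing m l t S (Z := hits (t + m).+1 ((t + m).+1 + l)) :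
  (1 <= m)%N -> adapted t S ->
  \int[Pr]_w (Phi (S w + Z w)%N)%:E <=
  \int[Pr]_w (\int[Pr]_v (Phi (S w + Z v)%N)%:E) + (psi m)%:E * 'E_pi[M].
Proof.
move=> m1 aS; rewrite /Z.
rewrite integral_block_value; last exact: adapted_le (leq_addr _ _) aS.
have := @mixing m t S (block_value l (t + m)) m1 aS
  (block_value_01 l (t + m)) (block_value_measurable l (t + m)).
congr (_ <= _ + _); apply: eq_integral => w _.
rewrite (integral_block_value l (S := fun=> S w)); last exact: adapted_cst.
rewrite (stationary (t + m)
  (u := block_value l (t + m) (S w)))//.
- by move=> y; exact: block_value_ge0.
- exact: block_value_measurable.
Qed.

End one_block.

Definition mean_hits m n : R := (\sum_(m <= i < n) fine (pi (D i)))%R.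

Lemma measurable_hit_real i : measurable_fun setT (fun w => (X i w \in D i)%:R : R).
Proof.
rewrite (_ : (fun _ => _) = (\1_(D i) : T -> R) \o X i)//.
exact: measurableT_comp.
Qed.

Lemma measurable_hits m n : measurable_fun setT (fun w => (hits m n w)%:R : R).
Proof.
rewrite (_ : (fun _ => _) = fun w => \sum_(m <= i < n) (X i w \in D i)%:R)%R.
  by apply: measurable_sum => i; exact: measurable_hit_real.
by apply/funext => w; rewrite natr_sum.
Qed.

Lemma integral_hits m n : \int[Pr]_w (hits m n w)%:R%:E = (mean_hits m n)%:E.
Proof.
under eq_integral do rewrite natr_sum -sumEFin.
rewrite ge0_integral_sum//; last first.
  by move=> i; apply/measurable_EFinP; exact: measurable_hit_real.
rewrite -sumEFin; apply: eq_bigr => i _.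
rewrite (stationary i (u := fun x => (\1_(D i) x)%:E))//.
  by rewrite integral_indic// setIT fineK// fin_num_measure.
exact/measurable_EFinP.
Qed.

Lemma hits_le m n w : (hits m n w <= n - m)%N.
Proof.
rewrite /hits (leq_trans (n := \sum_(m <= i < n) 1))%N//.
  by apply: leq_sum => i _; exact: leq_b1.
by rewrite sum_nat_const_nat muln1.
Qed.

Let measurable_fun_hits (f : nat -> R) m n :
  measurable_fun setT (fun w => (f (hits m n w))%:E).
Proof.
have mh := adapted_measurable (@adapted_hits n m n (leqnSn n)).
exact: (measurable_fun_fibers mh (f := fun s _ => (f s)%:E)).
Qed.

Variable L : nat.
Hypothesis L_gt0 : (0 < L)%N.

Lemma integral_block_exp (Phi : nat -> R) (C lam : R) m :
  (forall s, 0 <= Phi s)%R ->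
  (0 <= C)%R -> (0 <= lam)%R ->
  (forall s, Phi s <= C * expR (lam * s%:R))%R ->
  \int[Pr]_w (Phi (hits m (m + L) w))%:E <=
  (C * expR (lam * mean_hits m (m + L) + (lam * L%:R) ^+ 2 / 2))%:E.
Proof.
move=> Phi0 C0 lam0 PhiC.
have mexp : measurable_fun setT (fun w => expR (lam * (hits m (m + L) w)%:R)).
  apply: measurableT_comp => //; apply: measurable_funM => //.
  exact: measurable_hits.
apply: (@le_trans _ _
    (\int[Pr]_w (C%:E * (expR (lam * (hits m (m + L) w)%:R))%:E))).
  apply: ge0_le_integral => //.
  - by move=> w _; rewrite lee_fin.
  - by apply: measurable_funeM; exact/measurable_EFinP.
  - by move=> w _; rewrite -EFinM lee_fin.
rewrite ge0_integralZl//; last exact/measurable_EFinP.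
rewrite EFinM lee_wpmul2l ?lee_fin//.
apply: hoeffding_mgf => //.
- by move=> w; rewrite (leq_trans (hits_le _ _ _))// addKn.
- exact: measurable_hits.
- exact: integral_hits.
Qed.

(** Keeping one block of length L out of two leaves a gap of L steps between
    consecutive ones, over which the chain forgets its past. *)
Definition spaced_hits b r w : nat :=
  (\sum_(k < r) hits ((k.*2 + b) * L) ((k.*2 + b) * L + L) w)%N.

(** The predecessor is the last time of the last block that is counted. *)
Lemma adapted_spaced_hits b r :
  adapted ((r.*2 + b) * L + L).-1 (spaced_hits b r.+1).
Proof.
elim: r => [|r IH].
  rewrite (_ : spaced_hits b 1 = hits ((0.*2 + b) * L) ((0.*2 + b) * L + L)).
    by apply: adapted_hits; rewrite prednK// addn_gt0 L_gt0 orbT.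
  by apply/funext => w; rewrite /spaced_hits big_ord1.
rewrite (_ : spaced_hits b r.+2 = fun w => spaced_hits b r.+1 w +
    hits ((r.+1.*2 + b) * L) ((r.+1.*2 + b) * L + L) w)%N.
  apply: adaptedD; last first.
    by apply: adapted_hits; rewrite prednK// addn_gt0 L_gt0 orbT.
  apply: adapted_le IH; rewrite -!subn1 leq_sub2r// leq_add2r leq_mul2r.
  by rewrite leq_add2r leq_double leqnSn orbT.
by apply/funext => w; rewrite /spaced_hits big_ord_recr.
Qed.

(** Induction on the number of blocks.  The last block is decoupled from the
    others, and its independent copy is integrated out: this turns Phi into
    another function Psi with values in [0, 1], dominated by an exponential whose
    constant has grown by the moment of one block.  The error r * psi L * E_pi M
    does not involve C because Phi stays below 1. *)
Lemma spaced_hits_exp b r (Phi : nat -> R) (C lam : R) :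
  (forall s, 0 <= Phi s <= 1)%R -> (0 <= C)%R -> (0 <= lam)%R ->
  (forall s, Phi s <= C * expR (lam * s%:R))%R ->
  \int[Pr]_w (Phi (spaced_hits b r.+1 w))%:E <=
  (C * expR (\sum_(k < r.+1)
     (lam * mean_hits ((k.*2 + b) * L) ((k.*2 + b) * L + L) +
      (lam * L%:R) ^+ 2 / 2)))%:E + (r%:R * psi L)%:E * 'E_pi[M].
Proof.
move=> Phi01 C0 lam0; elim: r Phi C C0 Phi01 => [|r IH] Phi C C0 Phi01 PhiC.
  rewrite mul0r mul0e adde0 big_ord1.
  under eq_integral do rewrite /spaced_hits big_ord1.
  by apply: integral_block_exp => // s; have /andP[] := Phi01 s.
set m := ((r.+1.*2 + b) * L)%N.
(* The last time of the preceding block: the block to be decoupled starts right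
   after time t + L. *)
pose t := ((r.*2 + b) * L + L).-1.
have tL : (t + L).+1 = m.
  rewrite -addSn /t prednK ?addn_gt0 ?L_gt0 ?orbT// /m.
  by rewrite doubleS !addSn !mulSn addnC addnA [(L + _)%N in RHS]addnC; lia.
pose Psi s : R := fine (\int[Pr]_v (Phi (s + hits m (m + L) v)%N)%:E).
have int01 s : 0 <= \int[Pr]_v (Phi (s + hits m (m + L) v)%N)%:E <= 1.
  have Phi_01 v := Phi01 (s + hits m (m + L) v)%N.
  have Phi_ge0 v : 0 <= (Phi (s + hits m (m + L) v)%N)%:E.
    by rewrite lee_fin; have /andP[] := Phi_01 v.
  rewrite integral_ge0//=; apply: (@le_trans _ _ (\int[Pr]_v (cst 1 v))).
    apply: ge0_le_integral => //.
    - exact: (measurable_fun_hits (fun k => Phi (s + k)%N)).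
    - by move=> v _; rewrite lee_fin; have /andP[] := Phi_01 v.
  by rewrite integral_cst// mul1e probability_le1.
have PsiE s : \int[Pr]_v (Phi (s + hits m (m + L) v)%N)%:E = (Psi s)%:E.
  have /andP[h0 h1] := int01 s.
  by rewrite /Psi fineK// ge0_fin_numE// (le_lt_trans h1)// ltry.
have := @block_mixing Phi Phi01 L L t _ L_gt0 (@adapted_spaced_hits b r).
rewrite tL; under [X in _ <= X + _ -> _]eq_integral do rewrite PsiE.
under [X in _ -> X <= _]eq_integral do rewrite /spaced_hits big_ord_recr/=.
move=> /le_trans; apply.
set C' := (C * expR (lam * mean_hits m (m + L) + (lam * L%:R) ^+ 2 / 2))%R.
have C'0 : (0 <= C')%R by rewrite mulr_ge0 ?expR_ge0.
have Psi01 s : (0 <= Psi s <= 1)%R by rewrite -!lee_fin -PsiE.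
have PsiC s : (Psi s <= C' * expR (lam * s%:R))%R.
  rewrite -lee_fin -PsiE mulrAC.
  apply: (@integral_block_exp (fun k => Phi (s + k)%N)) => //.
  - by move=> k; have /andP[] := Phi01 (s + k)%N.
  - by rewrite mulr_ge0 ?expR_ge0.
  - by move=> k; rewrite -mulrA -expRD -mulrDr -natrD.
apply: (le_trans (leeD2r _ (IH Psi C' C'0 Psi01 PsiC))).
rewrite -addeA leeD//.
  rewrite lee_fin /C' -mulrA -expRD [in leRHS]big_ord_recr/=.
  by rewrite (addrC (lam * mean_hits m (m + L) + _)%R).
rewrite -ge0_muleDl ?lee_fin ?mulr_ge0 ?psi_ge0//.
by rewrite -EFinD -[X in (_ + X)%R]mul1r -mulrDl natr1.
Qed.

End visits.

(** * The number of visits to a set *)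

Variables (a n : nat) (gam : R).
Hypotheses (a_gt0 : (0 < a)%N) (gam_ge0 : (0 <= gam)%R).
Hypothesis an : (a.*2 <= n)%N.
Let p := (n %/ (2 * a))%N.
Let L := p.+1.

Let EM_ge0 : 0 <= 'E_pi[M].
Proof. exact: expectation_ge0. Qed.

Let p_gt0 : (0 < p)%N.
Proof. by rewrite divn_gt0 ?muln_gt0//= mul2n. Qed.

Let aL : (a * L <= n)%N.
Proof.
have := leq_divM n (2 * a); rewrite -/p /L.
by move: p_gt0; nia.
Qed.

Let n_aL : (n <= a.*2 * L)%N.
Proof. by rewrite -mul2n mulnC ltnW// -ltn_divLR ?muln_gt0. Qed.

Lemma measurable_spaced_hits (D : nat -> set T) b :
  (forall i, measurable (D i)) ->
  forall s, measurable [set w | spaced_hits D L b a w = s].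
Proof.
move=> mD; rewrite -[a](prednK a_gt0); apply: adapted_measurable.
exact: (@adapted_spaced_hits D mD L (ltn0Sn p) b a.-1).
Qed.

(** Chernoff's bound: the indicator of the deviation event is below
    exp (lam * (s - tau)). *)
Lemma spaced_hits_tail (D : nat -> set T) b
    (mu := (\sum_(k < a)
      mean_hits D ((k.*2 + b) * L) ((k.*2 + b) * L + L))%R) :
  (forall i, measurable (D i)) ->
  Pr [set w | (mu + n%:R * gam / 2 <= (spaced_hits D L b a w)%:R)%R] <=
  (expR (- (a%:R * gam ^+ 2 / 8)))%:E + (a%:R * psi p)%:E * 'E_pi[M].
Proof.
move=> mD; set tau := (mu + _)%R.
have n0 : (0 < n%:R :> R)%R by rewrite ltr0n (leq_trans _ an)// double_gt0.
pose lam : R := (a%:R * gam / (2 * n%:R))%R.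
have lam0 : (0 <= lam)%R by rewrite divr_ge0 ?mulr_ge0.
pose Phi s : R := (tau <= s%:R)%R%:R.
have ia : a = a.-1.+1 by rewrite prednK.
have mE : measurable [set w | (tau <= (spaced_hits D L b a w)%:R)%R].
  exact: (measurable_nat_preimage (measurable_spaced_hits b mD)
    [set s | tau <= s%:R]%R).
rewrite -[X in Pr X]setIT -integral_indic//.
rewrite (_ : \int[Pr]_(x in _) _ =
    \int[Pr]_w (Phi (spaced_hits D L b a w))%:E); last first.
  by apply: eq_integral => w _; rewrite indicE mem_setE.
have PhiC s : (Phi s <= expR (- (lam * tau)) * expR (lam * s%:R))%R.
  rewrite /Phi -expRD -[X in expR X](_ : lam * (s%:R - tau) = _)%R; last by ring.
  case: (boolP (tau <= s%:R)%R) => [h|_] /=; last exact: expR_ge0.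
  have -> : 1%:R = expR 0 :> R by rewrite expR0.
  by rewrite ler_expR mulr_ge0// subr_ge0.
have Phi01 s : (0 <= Phi s <= 1)%R.
  by rewrite /Phi ler0n lern1 leq_b1.
have := @spaced_hits_exp D mD L isT b a.-1 Phi _ lam Phi01 (expR_ge0 _) lam0 PhiC.
rewrite -ia => /le_trans; apply; apply: leeD; last first.
  rewrite lee_wpmul2r// lee_fin ler_pM ?psi_ge0//.
    by rewrite ler_nat leq_pred.
  exact: psi_decr.
rewrite lee_fin -expRD ler_expR big_split/= -mulr_sumr sumr_const card_ord.
rewrite -/mu -[X in (_ + (_ + X))%R]mulr_natl.
rewrite [leLHS](_ : _ = - (lam * (n%:R * gam / 2)) +
    a%:R * ((lam * L%:R) ^+ 2 / 2))%R; last by rewrite /tau; ring.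
apply: chernoff_exponent => //; first by rewrite ler1n.
by rewrite -natrM ler_nat.
Qed.

(** The 2 * a blocks of length L may extend beyond time n.  Visits at times from
    n on are discarded by making the target set empty there, which keeps all the
    blocks of equal length. *)
Lemma hits_tail (A : set T) : measurable A ->
  Pr [set w | (n%:R * (fine (pi A) + gam) <= (hits (fun=> A) 0 n w)%:R)%R] <=
  (2 * expR (- (a%:R * gam ^+ 2 / 8)))%:E +
  (2 * a%:R * psi p)%:E * 'E_pi[M].
Proof.
move=> mA; pose D i := if (i < n)%N then A else set0.
have mD i : measurable (D i) by rewrite /D; case: ifP.
have trunc (V : nmodType) (F : set T -> nat -> V) : (forall i, F set0 i = 0%R) ->
    (\sum_(0 <= i < a.*2 * L) F (D i) i = \sum_(0 <= i < n) F A i)%R.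
  move=> F0; rewrite (@big_cat_nat _ _ _ n)//=.
  rewrite [X in (_ + X)%R]big_nat [X in (_ + X)%R]big1.
    rewrite addr0 [LHS]big_nat [RHS]big_nat; apply: eq_bigr => i.
    by rewrite /D => /andP[_ ->].
  by move=> i /andP[ni _]; rewrite /D ltnNge ni.
have hitsE w : hits (fun=> A) 0 n w =
    (spaced_hits D L 0 a w + spaced_hits D L 1 a w)%N.
  rewrite /spaced_hits /hits -big_alternate_blocks.
  rewrite -(trunc nat (fun B i => (X i w \in B) : nat))// => i.
  by rewrite in_set0.
pose mu b := (\sum_(k < a)
  mean_hits D ((k.*2 + b) * L) ((k.*2 + b) * L + L))%R.
have muE : (n%:R * fine (pi A) = mu 0%N + mu 1%N)%R.
  rewrite /mu /mean_hits -big_alternate_blocks.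
  rewrite (trunc R (fun B _ => fine (pi B))); last by move=> _; rewrite measure0.
  by rewrite sumr_const_nat subn0 mulr_natl.
pose E b := [set w | (mu b + n%:R * gam / 2 <= (spaced_hits D L b a w)%:R)%R].
have mE b : measurable (E b).
  exact: (measurable_nat_preimage (measurable_spaced_hits b mD)
    [set s | mu b + n%:R * gam / 2 <= s%:R]%R).
apply: (@le_trans _ _ (Pr (E 0%N `|` E 1%N))).
  apply: le_measure; rewrite ?inE; [|exact: measurableU|].
    exact: (measurable_hits_preimage (D := fun=> A) (fun=> mA) 0 n
      [set s | n%:R * (fine (pi A) + gam) <= s%:R]%R).
  move=> w /=; rewrite hitsE natrD mulrDr muE => h.
  have [h0|h0] := leP (mu 0%N + n%:R * gam / 2)%R (spaced_hits D L 0 a w)%:R.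
    by left.
  by right => /=; exact: exceed_half h h0.
apply: (le_trans (measureU2 _ _ _)) => //.
apply: (le_trans (leeD (spaced_hits_tail 0 mD) (spaced_hits_tail 1 mD))).
rewrite addeACA -ge0_muleDl ?lee_fin ?mulr_ge0 ?psi_ge0// -!EFinD.
rewrite le_eqVlt; apply/orP; left; apply/eqP.
by congr (_%:E + _%:E * _); ring.
Qed.

End chain.

(** * Order statistics and quantiles *)

Local Open Scope ring_scope.

Section order_statistics.
Variables (R : realType) (s : seq R) (j : nat) (v : R).
Hypothesis js : (0 < j <= size s)%N.

Let sorted_s : sorted <=%R (sort <=%R s).
Proof. exact: sort_le_sorted. Qed.

Let j1s : (j.-1 < size (sort <=%R s))%N.
Proof. by have /andP[j0 jn] := js; rewrite size_sort prednK. Qed.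

Let jK : j.-1.+1 = j.
Proof. by have /andP[j0 _] := js; rewrite prednK. Qed.

Lemma order_stat_le : (order_stat s j <= v) = (j <= count (<= v) s)%N.
Proof.
rewrite -(@permP _ _ _ (permEl (perm_sort <=%R s))) /order_stat.
apply/idP/idP => [|h]; last by apply: nth_count_le; rewrite // jK.
apply: contraTT; rewrite -ltnNge -ltNge => h.
by apply: nth_count_gt => //; rewrite j1s andbT -ltnS jK.
Qed.

Lemma order_stat_lt : (order_stat s j < v) = (j <= count (< v) s)%N.
Proof.
rewrite -(@permP _ _ _ (permEl (perm_sort <=%R s))) /order_stat.
apply/idP/idP => [|h]; last by apply: nth_count_lt; rewrite // jK.
apply: contraTT; rewrite -ltnNge -leNgt => h.
by apply: nth_count_ge => //; rewrite j1s andbT -ltnS jK.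
Qed.

Lemma order_stat_gt : (v < order_stat s j) = (size s < count (> v) s + j)%N.
Proof.
by rewrite ltNge order_stat_le count_le_gt -ltnNge ltn_subLR ?count_size.
Qed.

End order_statistics.

Section quantiles.
Context d (T : measurableType d) (R : realType) (pi : probability T R).
Variables (g : {RV pi >-> R}) (q : R).
Hypothesis hq : 0 < q < 1.
Let F v := fine (cdf g v).

Let F_nondecreasing u v : u <= v -> F u <= F v.
Proof. by move=> uv; rewrite fine_le ?fin_num_measure// cdf_nondecreasing. Qed.

Let quantile_has_inf : has_inf [set v | q <= F v].
Proof.
have /andP[q0 q1] := hq; split.
  have /fine_cvg /cvgr_gt /(_ q q1) : cdf g v @[v --> +oo] --> 1%:E.
    exact: cvg_cdfy1.
  move=> [v [_ h]]; exists (v + 1) => /=; apply/ltW/h; lra.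
have /fine_cvg /cvgr_lt /(_ q q0) : cdf g v @[v --> -oo] --> 0%:E.
  exact: cvg_cdfNy0.
move=> [v [_ h]]; exists (v - 1) => u /= qFu.
rewrite leNgt; apply/negP => uv.
have : F u < q by apply: h; lra.
by rewrite ltNge qFu.
Qed.

Lemma quantile_upper eps : 0 < eps -> q <= F (quantile F q + eps).
Proof.
move=> eps0; have [v /= qv vx] := inf_adherent eps0 quantile_has_inf.
exact: le_trans qv (F_nondecreasing (ltW vx)).
Qed.

Lemma quantile_lower eps : 0 < eps -> F (quantile F q - eps) <= q.
Proof.
move=> eps0; rewrite leNgt; apply/negP => /ltW qF.
have := ge_inf (proj2 quantile_has_inf) qF.
rewrite -/(quantile F q); lra.
Qed.

End quantiles.

Lemma ltr_dist_or (R : realDomainType) (x c e : R) :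
  (e < `|x - c|) = (c + e < x) || (x < c - e).
Proof. by rewrite ltr_normr opprB !ltrBrDl [in RHS](addrC e). Qed.

Lemma count_hits d (T : measurableType d) (R : realType)
    dO (Omega : measurableType dO) (Pr : probability Omega R)
    (X : nat -> {RV Pr >-> T}) (g : T -> R) (p : pred R) n w :
  count p [seq g (X i w) | i <- iota 0 n] =
  hits X (fun=> [set x | p (g x)]) 0 n w.
Proof.
rewrite count_map -sum1_count big_mkcond /hits /index_iota subn0.
by apply: eq_bigr => i _ /=; rewrite mem_setE.
Qed.

Local Open Scope ring_scope.

Theorem theorem2 (R : realType) (d : nat) (hd : (1 <= d)%N)
  (X : set 'rV[R]_d) (X0 : X !=set0)
  (pi : probability (state_space X0) R) (hpi : support pi = setT)
  (P : R.-pker (state_space X0) ~> (state_space X0))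
  (hP : harris_ergodic P pi)
  (dO : measure_display) (Omega : measurableType dO) (Pr : probability Omega R)
  (Xc : nat -> {RV Pr >-> state_space X0}) (hXc : markov_chain P Xc)
  (hstat : forall A, measurable A -> distribution Pr (Xc 0%N) A = pi A)
  (M : state_space X0 -> R) (mM : measurable_fun setT M)
  (M_ge0 : forall x, 0 <= M x) (EM : ('E_pi[M] < +oo)%E)
  (psi : nat -> R) (psi_ge0 : forall n, (1 <= n)%N -> 0 <= psi n)
  (psi_decr : forall m n, (1 <= m)%N -> (m <= n)%N -> psi n <= psi m)
  (hTV : forall x n, (1 <= n)%N ->
     (tv_dist (nstep P n x) pi <= (M x * psi n)%:E)%E)
  (g : {RV pi >-> R}) (q : R) (hq : 0 < q < 1)
  (F := fun v : R => fine (cdf g v)) (xi := quantile F q)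
  (f : R -> \bar R) (hf : continuous_density F f) (hfxi : (0 < f xi < +oo)%E)
  (n j a : nat) (hj : j%:R - 1 < n%:R * q <= j%:R)
  (ha : 1 <= (a%:R : R) <= n%:R / 2)
  (eps : R) (heps : 0 < eps) (delta : R) (hdelta : 0 < delta < 1)
  (gamma := Num.min (F (xi + eps) - q) (delta * (q - F (xi - eps))))
  (xi_hat := fun w : Omega => order_stat [seq g (Xc i w) | i <- iota 0 n] j) :
  (Pr [set w | (eps < `|xi_hat w - xi|)%R] <=
    (8 * expR (- (a%:R * gamma ^+ 2 / 8)))%:E +
    (22 * a%:R * Num.sqrt (1 + 4 / gamma) * psi (n %/ (2 * a))%N)%:E
      * 'E_pi[M])%E.
Proof.
have [inv_pi _ _ _] := hP.
have EM0 : (0 <= 'E_pi[M])%E by exact: expectation_ge0.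
have /andP[q0 q1] := hq.
have /andP[d0 d1] := hdelta.
have FU : q <= F (xi + eps) := quantile_upper g hq heps.
have FL : F (xi - eps) <= q := quantile_lower g hq heps.
have gam0 : 0 <= gamma.
  by rewrite /gamma le_min subr_ge0 FU mulr_ge0 ?(ltW d0)// subr_ge0.
have gamU : gamma <= F (xi + eps) - q by rewrite /gamma ge_min lexx.
have gamL : gamma <= q - F (xi - eps).
  rewrite /gamma ge_min; apply/orP; right.
  by rewrite ler_piMl ?(ltW d1)// subr_ge0.
have /andP[a1 a2] := ha.
have a_gt0 : (0 < a)%N by move: a1; rewrite ler1n.
have an : (a.*2 <= n)%N.
  by move: a2; rewrite ler_pdivlMr// -natrM ler_nat muln2.
have n0 : 0 < n%:R :> R by rewrite ltr0n (leq_trans _ an)// double_gt0.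
have /andP[j1 j2] := hj.
have jn : (0 < j <= n)%N.
  apply/andP; split.
    by rewrite -(ltr0n R); apply: lt_le_trans j2; rewrite mulr_gt0.
  rewrite -ltnS -(ltr_nat R) -natr1.
  by rewrite -ltrBlDr (lt_trans j1)// gtr_pMr.
set p := (n %/ (2 * a))%N.
have p_gt0 : (0 < p)%N by rewrite divn_gt0 ?muln_gt0//= mul2n.
pose above := [set x | xi + eps < g x].
pose below := [set x | g x < xi - eps].
have m_above : measurable above.
  rewrite (_ : above = g @^-1` `]xi + eps, +oo[); first exact: measurable_funPTI.
  by apply/seteqP; split => x; rewrite /= in_itv/= andbT.
have m_below : measurable below.
  rewrite (_ : below = g @^-1` `]-oo, xi - eps[); first exact: measurable_funPTI.
  by apply/seteqP; split => x; rewrite /= in_itv.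
have pi_above : fine (pi above) = 1 - F (xi + eps).
  rewrite (_ : above = ~` (g @^-1` `]-oo, xi + eps])); last first.
    apply/seteqP; split => x; rewrite /above /= in_itv/=.
      by move=> h; rewrite leNgt h.
    by move=> /negP; rewrite -ltNge.
  rewrite probability_setC; last exact: measurable_funPTI.
  by rewrite fineB ?fin_num_measure//; exact: measurable_funPTI.
have pi_below : fine (pi below) <= F (xi - eps).
  apply: fine_le; [exact: fin_num_measure|exact: fin_num_measure|].
  apply: le_measure; rewrite ?inE//; first exact: measurable_funPTI.
  by move=> x /= /ltW; rewrite in_itv.
pose N A w := hits Xc (fun=> A) 0 n w.
pose E A := [set w | n%:R * (fine (pi A) + gamma) <= (N A w)%:R].
have mN A (Q : set nat) : measurable A -> measurable [set w | Q (N A w)].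
  by move=> mA; exact: (measurable_hits_preimage Xc (D := fun=> A) (fun=> mA)).
have mE A : measurable A -> measurable (E A).
  by move=> mA; exact: (mN A [set s | n%:R * (fine (pi A) + gamma) <= s%:R]).
have eventE : [set w | eps < `|xi_hat w - xi|] =
    [set w | (n < N above w + j)%N] `|` [set w | (j <= N below w)%N].
  have sz w : size [seq g (Xc i w) | i <- iota 0 n] = n.
    by rewrite size_map size_iota.
  have jw w : (0 < j <= size [seq g (Xc i w) | i <- iota 0 n])%N by rewrite sz.
  have upE w : (xi + eps < xi_hat w) = (n < N above w + j)%N.
    by rewrite /xi_hat order_stat_gt// sz count_hits.
  have loE w : (xi_hat w < xi - eps) = (j <= N below w)%N.
    by rewrite /xi_hat order_stat_lt// count_hits.
  by apply/seteqP; split => w /=; rewrite ltr_dist_or upE loE => /orP.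
have tail :=
  hits_tail hXc inv_pi hstat mM M_ge0 psi_ge0 psi_decr hTV a_gt0 gam0 an.
apply: (@le_trans _ _ (Pr (E above `|` E below))).
  apply: le_measure; rewrite ?inE.
  - rewrite eventE; apply: measurableU; first exact: (mN _ [set s | n < s + j]%N).
    exact: (mN _ [set s | j <= s]%N).
  - by apply: measurableU; exact: mE.
  rewrite eventE => w [] /= h; [left|right]; rewrite /E /=.
    have le1 : n%:R * (fine (pi above) + gamma) <= n%:R * (1 - q).
      rewrite ler_pM2l// pi_above -addrA lerD2l addrC lerBlDr.
      by rewrite addrC; exact: gamU.
    apply: (le_trans le1); rewrite mulrBr mulr1 lerBlDr.
    apply: (@le_trans _ _ ((N above w)%:R + (j%:R - 1))); last first.
      by rewrite lerD2l ltW.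
    by rewrite addrA lerBrDr natr1 -natrD ler_nat.
  have le2 : n%:R * (fine (pi below) + gamma) <= n%:R * q.
    rewrite ler_pM2l//; apply: (le_trans (lerD pi_below gamL)).
    by rewrite addrC subrK.
  by apply: (le_trans le2); apply: (le_trans j2); rewrite ler_nat.
apply: (le_trans (measureU2 _ (mE _ m_above) (mE _ m_below))).
apply: (le_trans (leeD (tail _ m_above) (tail _ m_below))).
rewrite addeACA -ge0_muleDl ?lee_fin ?mulr_ge0 ?psi_ge0// -!EFinD.
apply: leeD.
  by rewrite lee_fin -mulrDl ler_wpM2r ?expR_ge0// -natrD ler_nat.
rewrite lee_wpmul2r// lee_fin.
have sqrt1 : 1 <= Num.sqrt (1 + 4 / gamma).
  by rewrite -[leLHS]sqrtr1 ler_wsqrtr// lerDl divr_ge0.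
rewrite -/p -mulrDl -mulrDl ler_wpM2r ?psi_ge0//.
rewrite -[leLHS]mulr1 ler_pM ?mulr_ge0 ?addr_ge0//.
by rewrite ler_wpM2r// -natrD ler_nat.
Qed.
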